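(* Let $\mathbf{X}=(X,\mathcal{B}_X,\mu,T)$ be a measure-preserving $\mathbb{Z}$-system and let $L(n)=\log n$. Then $\mathbf{X}$ is mildly mixing if and only if for all partitions $P$ of $X$ and all F\o lner sequences $(F_n)$ for $\mathbb{N}$, we have $h_{\mathrm{slow}}^{L,(F_n)}(\mathbf{X},P)>0$.
   Context: $\mathbf{X}$ consists of a standard probability space $(X,\mathcal{B}_X,\mu)$ and an invertible measure-preserving transformation $T$. A system $(Y,\mathcal{B}_Y,\nu,S)$ is rigid if there is a sequence $0=n_0<n_1<n_2<\cdots$ with $\lim_{k\to\infty}\nu(S^{-n_k}A\,\triangle\,A)=0$ for all measurable $A\subseteq Y$. $\mathbf{X}$ is mildly mixing if it has no nontrivial rigid factors (a factor is trivial if it is a one-point system modulo null sets). All partitions are finite and measurable. For $P=\{P_0,\dots,P_{r-1}\}$, $P(x)$ is the index $i$ with $x\in P_i$. A F\o lner sequence for $\mathbb{N}=\{0,1,2,\dots\}$ is a sequence of finite nonempty sets $F_n\subseteq\mathbb{N}$ with $|(F_n+k)\cap F_n|/|F_n|\to1$ for every $k\in\mathbb{N}$ (so $|F_n|\to\infty$, and only the values of $L$ at large integers matter). For finite $F\subseteq\mathbb{N}$, $d_{P,F}(x,x')=\frac1{|F|}\sum_{f\in F}1_{P(T^fx)\ne P(T^fx')}$, with corresponding diameter $\operatorname{diam}_{P,F}$. For $\epsilon>0$, $\operatorname{cov}(\mu,P,F,\epsilon)$ is the smallest $M$ such that there exist $E_1,\dots,E_M\subseteq X$ with $\operatorname{diam}_{P,F}(E_i)\le\epsilon$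 for all $i$ and $\mu(\bigcup E_i)\ge1-\epsilon$. Finally $$h_{\mathrm{slow}}^{L,(F_n)}(\mathbf{X},P)=\sup_{\epsilon>0}\limsup_{n\to\infty}\frac{\operatorname{cov}(\mu,P,F_n,\epsilon)}{L(|F_n|)}.$$
   Formalization: ''All partitions P'' is read as all partitions with no cell of full measure: if a cell has measure 1 then the covering number is at most 1, so the slow entropy is 0 in every system and the literal claim fails for every mildly mixing system. *)

(* Defs.v *)
From HB Require Import structures.
From mathcomp Require Import all_boot all_order all_algebra finmap.
From mathcomp Require Import all_classical all_reals all_analysis.
Import Order.TTheory GRing.Theory Num.Theory.
Import numFieldNormedType.Exports.

Set Implicit Arguments.
Unset Strict Implicit.
Unset Printing Implicit Defensive.

Local Open Scope classical_set_scope.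
Local Open Scope ring_scope.

(* The sigma-algebra of X is the Borel sigma-algebra of a Polish topology: X is
   isomorphic to a Polish space U, that is, a complete (extended pseudo)metric
   space that is Hausdorff (so the pseudometric separates points) and
   separable. *)
Definition standard_borel (R : realType) (d : measure_display)
    (X : measurableType d) : Prop :=
  exists (U : completePseudoMetricType R) (f : X -> U),
    [/\ hausdorff_space U,
        exists2 D : set U, countable D & dense D,
        bijective f &
        forall A : set X, measurable A <-> <<s @open U >> (f @` A)].

Definition invertible_mpt (R : realType) (d : measure_display)
    (X : measurableType d) (mu : probability X R) (T : X -> X) : Prop :=
  [/\ measurable_fun setT T,
      exists2 T' : X -> X,
        measurable_fun setT T' & cancel T T' /\ cancel T' T &
      forall A : set X, measurable A -> mu (T @^-1` A) = mu A].

Definition mp_system (R : realType) (d : measure_display)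
    (X : measurableType d) (mu : probability X R) (T : X -> X) : Prop :=
  standard_borel R X /\ invertible_mpt mu T.

Definition rigid (R : realType) (d : measure_display)
    (Y : measurableType d) (nu : probability Y R) (S : Y -> Y) : Prop :=
  exists n : nat -> nat,
    [/\ n 0%N = 0%N,
        (forall i j : nat, (i < j)%N -> (n i < n j)%N) &
        forall A : set Y, measurable A ->
          nu ((iter (n k) S @^-1` A) `+` A) @[k --> \oo] --> 0%E].

Definition is_factor (R : realType) (d d' : measure_display)
    (X : measurableType d) (mu : probability X R) (T : X -> X)
    (Y : measurableType d') (nu : probability Y R) (S : Y -> Y) : Prop :=
  exists pi : X -> Y,
    [/\ measurable_fun setT pi,
        (forall A : set Y, measurable A -> mu (pi @^-1` A) = nu A) &
        {ae mu, forall x, pi (T x) = S (pi x)}].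

Definition trivial_system (R : realType) (d : measure_display)
    (Y : measurableType d) (nu : probability Y R) : Prop :=
  exists y0 : Y, {ae nu, forall y, y = y0}.

Definition mildly_mixing (R : realType) (d : measure_display)
    (X : measurableType d) (mu : probability X R) (T : X -> X) : Prop :=
  forall (d' : measure_display) (Y : measurableType d')
    (nu : probability Y R) (S : Y -> Y),
    mp_system nu S -> is_factor mu T nu S -> rigid nu S -> trivial_system nu.

Definition is_partition (d : measure_display) (X : measurableType d) (r : nat)
    (P : 'I_r -> set X) : Prop :=
  [/\ forall i, measurable (P i),
      trivIset setT P &
      \bigcup_i P i = setT].

(* Modulo null sets, P is not the one-piece partition {X}. *)
Definition nontrivial_partition (R : realType) (d : measure_display)
    (X : measurableType d) (mu : probability X R) (r : nat)
    (P : 'I_r -> set X) : Prop :=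
  forall i, mu (P i) != 1%E.

(* P(x); it is never None when P is a partition. *)
Definition part_index (X : Type) (r : nat) (P : 'I_r -> set X) (x : X) :
    option 'I_r :=
  [pick i | x \in P i].

Definition folner (R : realType) (F : nat -> {fset nat}) : Prop :=
  (forall n, F n != fset0) /\
  forall k : nat,
    (#|` ([fset (f + k)%N | f in F n] `&` F n)%fset|%:R / #|` F n|%:R : R)
      @[n --> \oo] --> (1 : R).

Definition hamming (R : realType) (X : Type) (T : X -> X) (r : nat)
    (P : 'I_r -> set X) (F : {fset nat}) (x x' : X) : R :=
  (\sum_(f <- F)
     (part_index P (iter f T x) != part_index P (iter f T x'))%:R) / #|` F|%:R.

(* The supremum is over a subset of [0, 1]; the diameter of set0 is 0. *)
Definition diam (R : realType) (X : Type) (T : X -> X) (r : nat)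
    (P : 'I_r -> set X) (F : {fset nat}) (E : set X) : R :=
  sup [set hamming R T P F x x' | x in E & x' in E].

(* The infimum of a set of natural numbers, so a minimum when the set is not
   empty, which is the case for a partition P and eps > 0. Measurability of the
   pieces is no restriction: replacing a piece by its saturation for the finite
   partition generated by the T^-f P, f in F, does not change its diameter. *)
Definition cov (R : realType) (d : measure_display) (X : measurableType d)
    (mu : probability X R) (T : X -> X) (r : nat) (P : 'I_r -> set X)
    (F : {fset nat}) (eps : R) : R :=
  inf [set M%:R | M in [set M : nat | exists E : 'I_M -> set X,
    [/\ forall i, measurable (E i),
        forall i, diam R T P F (E i) <= eps &
        ((1 - eps)%:E <= mu (\bigcup_i E i))%E]]].

Definition h_slow (R : realType) (d : measure_display) (X : measurableType d)
    (mu : probability X R) (T : X -> X) (L : nat -> R) (F : nat -> {fset nat})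
    (r : nat) (P : 'I_r -> set X) : \bar R :=
  ereal_sup [set
    limn_esup (fun n => (cov mu T P (F n) eps / L #|` F n|)%:E)
    | eps in [set eps : R | 0 < eps]].

(* Main.v *)
Require Import Defs.
From HB Require Import structures.
From mathcomp Require Import all_boot all_order all_algebra finmap.
From mathcomp Require Import all_classical all_reals all_analysis.
From mathcomp Require Import measurable_realfun.
From mathcomp Require Import zify lra.
Import Order.TTheory GRing.Theory Num.Theory.
Import numFieldNormedType.Exports.
Local Open Scope classical_set_scope.
Local Open Scope ring_scope.
Set Implicit Arguments.
Unset Strict Implicit.
Unset Printing Implicit Defensive.

(** Mild mixing is detected by slow entropy at the scale [log |F|] because that
    is exactly the scale at which the pigeonhole principle produces returns.

    Suppose that a set [F] of times admits a covering of most of [X] by [M]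
    sets of small Hamming diameter, and let [A] be a cell of the partition.
    For most [f] in [F] the set [T^-f A] is, up to a small error, a union of
    pieces of the covering, so it is described by a code in [{0,1}^M].  If [M]
    is much smaller than [log |F|], there are far fewer codes than times, so
    two times [f < g] that are far apart share a code.  Then [T^-f A] and
    [T^-g A] nearly agree, and by invariance [T^-(g-f) A] is close to [A]: this
    is [covering_return].  If the slow entropy vanishes, this happens with
    arbitrarily small error and arbitrarily large [g - f], which gives times
    [n_k] along which [A] is rigid ([rigidity_times]).  The sets that are rigid
    along [n_k] form a sigma-algebra ([recurrent_sigma_algebra]).  Hence the
    factor generated by [A], realized as the shift on [{0,1}^Z] with the law
    of the itinerary [i |-> (T^i x in A)], is a rigid factor, nontrivial as
    soon as [0 < mu A < 1].

    Conversely, let [Y] be a nontrivial rigid factor and let [B] be the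
    preimage in [X] of a set of measure strictly between 0 and 1.  A union of
    [K] translates [m_i + {0,...,N-1}] of an interval by rigidity times [m_i]
    is almost invariant under small shifts whatever [K] is.  For most points
    the name along this union is determined by the name along a single
    interval, so [2^N] pieces suffice to cover, whereas [K] can be chosen so
    that [log K] exceeds [N 2^N].  Letting [N] grow yields a Folner sequence
    along which the slow entropy of the partition into [B] and its complement
    vanishes ([rigid_slow_folner]). *)

(** * The compact space of bi-infinite binary sequences *)

(** The radius of a ball lives in [R], so the metric structure, and with it the
    canonical instances, have to be indexed by [R]. *)
Definition binseq (R : realType) : Type := int -> bool.

Section BinarySequences.
Variable R : realType.
Implicit Types x y z : binseq R.

(** Ball of the ultrametric [1 / (1 + |i|)], with [i] the position of smallest
    absolute value at which the sequences differ.  Balls of nonpositive radius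
    are empty, without which the triangle inequality would fail. *)
Definition binseq_ball x (e : R) y : Prop :=
  0 < e /\ forall i : int, e <= (absz i).+1%:R^-1 -> x i = y i.

Lemma binseq_ball_center x (e : R) : 0 < e -> binseq_ball x e x.
Proof. by []. Qed.

Lemma binseq_ball_sym x y (e : R) : binseq_ball x e y -> binseq_ball y e x.
Proof. by move=> [e0 xy]; split=> // i /xy. Qed.

Lemma binseq_ball_triangle x y z (e1 e2 : R) :
  binseq_ball x e1 y -> binseq_ball y e2 z -> binseq_ball x (e1 + e2) z.
Proof.
move=> [e10 xy] [e20 yz]; split=> [|i ei]; first exact: addr_gt0.
rewrite xy ?yz //; apply: le_trans ei.
- by rewrite lerDr ltW.
- by rewrite lerDl ltW.
Qed.

HB.instance Definition _ := Pointed.copy (binseq R) (int -> bool).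
HB.instance Definition _ :=
  hasNbhs.Build (binseq R) (nbhs_ (entourage_ binseq_ball)).
HB.instance Definition _ :=
  Nbhs_isPseudoMetric.Build R (binseq R) (erefl _) binseq_ball_center
    binseq_ball_sym binseq_ball_triangle (erefl _).

(** Along a Cauchy filter each coordinate is eventually constant; the sequence
    of these constants is the limit. *)
Lemma binseq_complete (F : set_system (binseq R)) :
  ProperFilter F -> cauchy F -> cvg F.
Proof.
move=> FF /cauchyP Fc.
have Fval (i : int) : exists b, F [set y : binseq R | y i = b].
  have i0 : 0 < ((absz i).+1%:R^-1 : R) by rewrite invr_gt0.
  have [x Fx] := Fc _ i0; exists (x i).
  by apply: filterS Fx => y [_ /(_ i (lexx _))].
have [l Fl] := choice Fval.
apply/cvg_ex; exists (l : binseq R) => A /nbhs_ballP [e /= e0 lA].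
have [x Fx] := Fc _ e0.
apply: (filterS _ Fx) => y [_ xy]; apply: lA; split=> // i ei.
have [z [[_ xz] <-]] := filter_ex (filterI Fx (Fl i)).
by rewrite -(xz _ ei) (xy _ ei).
Qed.

HB.instance Definition _ := Uniform_isComplete.Build (binseq R) binseq_complete.

Lemma binseq_hausdorff : hausdorff_space (binseq R).
Proof.
move=> x y xy; apply/funext => i.
have i0 : 0 < ((absz i).+1%:R^-1 : R) by rewrite invr_gt0.
have [z [[_ xz] [_ yz]]] :=
  xy _ _ (nbhsx_ballx x _ i0) (nbhsx_ballx y _ i0).
by rewrite (xz _ (lexx _)) -(yz _ (lexx _)).
Qed.

(** Cylinders are indexed by finite data, so there are countably many. *)
Definition cylinder (N : nat) (s : seq int) : set (binseq R) :=
  [set y | forall i : int, (absz i <= N)%N -> y i = (i \in s)].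

Lemma nbhs_cylinder x (A : set (binseq R)) : nbhs x A ->
  exists N s, cylinder N s x /\ cylinder N s `<=` A.
Proof.
move=> /nbhs_ballP[e /= e0 xA].
have [N Ne] : exists N : nat, N.+1%:R^-1 < e.
  exists (Num.truncn e^-1); rewrite invf_plt ?posrE//.
  exact: truncnS_gt.
pose s := [seq i : int <- map Posz (iota 0 N.+1) ++
                          map (fun n => - Posz n) (iota 0 N.+1) | x i].
have xs (i : int) : (absz i <= N)%N -> x i = (i \in s).
  move=> iN; rewrite mem_filter mem_cat.
  suff -> : (i \in map Posz (iota 0 N.+1)) ||
      (i \in map (fun n => - Posz n) (iota 0 N.+1)) by rewrite andbT.
  case: i iN => n nN.
  - by rewrite map_f// mem_iota ltnS.
  - by rewrite NegzE (map_f (fun n => - Posz n)) ?orbT// mem_iota ltnS.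
exists N, s; split=> // y ys; apply: xA; split=> // i ei.
have iN : (absz i <= N)%N.
  rewrite leqNgt; apply/negP => Ni.
  have := lt_le_trans Ne ei.
  by rewrite ltf_pV2 ?posrE// ltr_nat ltnS ltnNge (ltnW Ni).
by rewrite xs ?ys.
Qed.

Lemma binseq_separable : exists2 D : set (binseq R), countable D & dense D.
Proof.
exists (range (fun s : seq int => (fun i => i \in s) : binseq R)).
  by apply: sub_countable (card_image_le _ _) _; exact: countableP.
move=> O [x Ox] oO.
have [N [s [_ sO]]] := nbhs_cylinder (open_nbhs_nbhs (conj oO Ox)).
by exists (fun i => i \in s); split; [exact: sO|exists s].
Qed.

Lemma open_coordinate (i : int) : open [set y : binseq R | y i].
Proof.
rewrite openE => x /= xi; apply/nbhs_ballP.
exists ((absz i).+1%:R^-1) => /=; first by rewrite invr_gt0.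
by move=> y [_ /(_ i (lexx _))] /= <-.
Qed.

(** Coordinates generate the Borel sets: each cylinder is a countable
    intersection of coordinate conditions, and each open set is a countable
    union of cylinders.  This gives an induction principle, used both for
    measurability and for rigidity. *)
Section Generation.
Variable G : set (set (binseq R)).
Hypothesis sG : sigma_algebra setT G.
Hypothesis Gcoord : forall i, G [set y : binseq R | y i].

Let GC A : G A -> G (~` A).
Proof. by case: sG => _ h _ /h; rewrite setTD. Qed.

Let GI (A : nat -> set (binseq R)) : (forall n, G (A n)) -> G (\bigcap_n A n).
Proof.
move=> h; rewrite -[X in G X]setCK setC_bigcap; apply: GC.
by case: sG => _ _; apply => n; exact: GC.
Qed.

Let Gcylinder N s : G (cylinder N s).
Proof.
have GT : G setT by rewrite -setC0; apply: GC; case: sG.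
pose A n : set (binseq R) := if (choice.unpickle n : option int) is Some i then
  if (absz i <= N)%N then [set y | y i = (i \in s)] else setT else setT.
have -> : cylinder N s = \bigcap_n A n.
  apply/seteqP; split=> y.
  - by move=> h n _; rewrite /A; case: (choice.unpickle n) => // i; case: ifP => // /h.
  - by move=> h i iN; have := h (choice.pickle i) I; rewrite /A choice.pickleK iN.
apply: GI => n; rewrite /A; case: choice.unpickle => // i; case: ifP => // _.
case: (i \in s); first exact: Gcoord.
rewrite (_ : [set _ | _] = ~` [set y : binseq R | y i]); first exact: GC.
by apply/seteqP; split=> y /=; [move=> ->|move=> /negP/negbTE].
Qed.

Lemma borel_binseq_ind (A : set (binseq R)) : <<s @open (binseq R) >> A -> G A.
Proof.
suff oG : @open (binseq R) `<=` G by apply: smallest_sub.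
move=> O oO.
pose C n : set (binseq R) := if (choice.unpickle n : option (nat * seq int)) is Some (N, s) then
  if `[< cylinder N s `<=` O >] then cylinder N s else set0 else set0.
have -> : O = \bigcup_n C n.
  apply/seteqP; split=> y.
  - move=> Oy.
    have [N [s [ys sO]]] := nbhs_cylinder (open_nbhs_nbhs (conj oO Oy)).
    by exists (choice.pickle (N, s)) => //; rewrite /C choice.pickleK; case: asboolP.
  - by move=> [n _]; rewrite /C; case: choice.unpickle => // -[N s]; case: asboolP => // /[apply].
case: (sG) => G0 _; apply => n; rewrite /C.
by case: choice.unpickle => // -[N s]; case: ifP.
Qed.

End Generation.

Definition binseq_borel := g_sigma_algebraType (@open (binseq R)).

Lemma standard_borel_binseq : standard_borel R binseq_borel.
Proof.
exists (binseq R), id; split.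
- exact: binseq_hausdorff.
- exact: binseq_separable.
- by exists id.
- by move=> A; rewrite image_id.
Qed.

End BinarySequences.

(** * Probabilities as real numbers *)

Lemma measurable_setY (d : measure_display) (X : measurableType d) (A B : set X) :
  measurable A -> measurable B -> measurable (A `+` B).
Proof. by move=> mA mB; apply: measurableU; apply: measurableD. Qed.

Section RealProbability.
Variables (R : realType) (d : measure_display) (X : measurableType d).
Variable mu : probability X R.

Definition Pr (A : set X) : R := fine (mu A).

Lemma PrE A : measurable A -> mu A = (Pr A)%:E.
Proof. by move=> mA; rewrite /Pr fineK// fin_num_measure. Qed.

Lemma Pr_ge0 A : 0 <= Pr A.
Proof. by rewrite /Pr fine_ge0. Qed.

Lemma PrS A B : measurable A -> measurable B -> A `<=` B -> Pr A <= Pr B.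
Proof.
by move=> mA mB AB; rewrite -lee_fin -!PrE// le_measure// inE.
Qed.

Lemma Pr0 : Pr set0 = 0.
Proof. by rewrite /Pr measure0. Qed.

Lemma PrC A : measurable A -> Pr (~` A) = 1 - Pr A.
Proof.
move=> mA; apply: EFin_inj; rewrite -PrE; last exact: measurableC.
by rewrite probability_setC// EFinB PrE.
Qed.

Lemma PrU A B : measurable A -> measurable B -> Pr (A `|` B) <= Pr A + Pr B.
Proof.
move=> mA mB; rewrite -lee_fin EFinD -!PrE//; last exact: measurableU.
exact: measureU2.
Qed.

Lemma Pr_bigU (I : Type) (s : seq I) (A : I -> set X) :
  (forall i, measurable (A i)) ->
  Pr (\big[setU/set0]_(i <- s) A i) <= \sum_(i <- s) Pr (A i).
Proof.
move=> mA; elim: s => [|i s IH]; first by rewrite !big_nil Pr0.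
rewrite !big_cons; apply: le_trans (_ : _ <= _ + Pr (\big[setU/set0]_(j <- s) A j)) _.
  by apply: PrU => //; exact: bigsetU_measurable.
by rewrite lerD2l.
Qed.

(** Rigidity is a statement on limits of measures of symmetric differences;
    the estimates below are done on this epsilon form. *)
Lemma cvg_mu0P (A : nat -> set X) : (forall k, measurable (A k)) ->
  mu (A k) @[k --> \oo] --> 0%E <->
  forall e, 0 < e -> exists N, forall k, (N <= k)%N -> Pr (A k) <= e.
Proof.
move=> mA.
have -> : (fun k => mu (A k)) = (fun k => (Pr (A k))%:E).
  by apply/funext => k; exact: PrE.
split=> [/fine_cvgP[_ /cvgr0Pnorm_le h] e e0|h].
  have [N _ hN] := h _ e0; exists N => k /hN /=.
  exact: le_trans (ler_norm _).
apply: cvg_EFin; first exact: nearW.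
apply/cvgr0Pnorm_le => e e0; have [N hN] := h _ e0; exists N => // k /hN /=.
by rewrite ger0_norm// Pr_ge0.
Qed.

Lemma Pr_bigcup_tail (A : nat -> set X) (e : R) : (forall j, measurable (A j)) ->
  0 < e -> exists J, Pr (\bigcup_j A j `\` \big[setU/set0]_(j < J) A j) <= e.
Proof.
move=> mA e0; pose B J := \bigcup_j A j `\` \big[setU/set0]_(j < J) A j.
have mU : measurable (\bigcup_j A j) by exact: bigcupT_measurable.
have mB J : measurable (B J).
  by apply: measurableD => //; exact: bigsetU_measurable.
have B0 : \bigcap_J B J = set0.
  apply/seteqP; split=> // x xB.
  have [[j _ Ajx] _] := xB 0%N I.
  have [_] := xB j.+1 I; apply.
  by rewrite big_ord_recr /=; right.
have Bcvg : mu (B J) @[J --> \oo] --> 0%E.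
  rewrite -(measure0 mu) -B0; apply: nonincreasing_cvg_mu => //.
  - by rewrite -ge0_fin_numE// fin_num_measure.
  - by rewrite B0.
  - apply/nonincreasing_seqP => n; apply/subsetPset => x [Ux nx]; split=> // nx'.
    by apply: nx; rewrite big_ord_recr/=; left.
by have [N /(_ N (leqnn N))] := (cvg_mu0P mB).1 Bcvg _ e0; exists N.
Qed.

End RealProbability.

(** * Recurrence along a sequence of times *)

Section Recurrence.
Variables (R : realType) (d : measure_display) (X : measurableType d).
Variables (mu : probability X R) (T : X -> X).
Hypothesis mT : measurable_fun setT T.
Hypothesis muT : forall A, measurable A -> mu (T @^-1` A) = mu A.

Lemma measurable_iter m (A : set X) : measurable A -> measurable (iter m T @^-1` A).
Proof.
elim: m A => [//|m IH] A mA.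
rewrite (_ : _ @^-1` A = iter m T @^-1` (T @^-1` A)); last by [].
by apply: IH; rewrite -[X in measurable X]setTI; exact: mT.
Qed.

Lemma Pr_iter m (A : set X) : measurable A -> Pr mu (iter m T @^-1` A) = Pr mu A.
Proof.
elim: m A => [//|m IH] A mA.
have mTA : measurable (T @^-1` A) by rewrite -[X in measurable X]setTI; exact: mT.
rewrite (_ : _ @^-1` A = iter m T @^-1` (T @^-1` A)); last by [].
by rewrite IH// /Pr muT.
Qed.

Lemma measurable_return m (A : set X) : measurable A ->
  measurable ((iter m T @^-1` A) `+` A).
Proof. by move=> mA; apply: measurable_setY => //; exact: measurable_iter. Qed.

(** Stability under countable unions is the point: a union is approximated in
    measure by a finite subunion, and by invariance [T^-n] of the remainder is
    as small as the remainder, uniformly in [n]. *)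
Lemma recurrent_sigma_algebra (n : nat -> nat) : sigma_algebra setT
  [set A | measurable A /\
    mu ((iter (n k) T @^-1` A) `+` A) @[k --> \oo] --> 0%E].
Proof.
set G := (X in sigma_algebra _ X).
have G0 : G set0.
  split=> //; under eq_fun do rewrite preimage_set0 setYK measure0.
  exact: cvg_cst.
have mR k A : measurable A -> measurable ((iter (n k) T @^-1` A) `+` A).
  exact: measurable_return.
have GP A : measurable A -> G A <-> forall e, 0 < e ->
    exists N, forall k, (N <= k)%N -> Pr mu ((iter (n k) T @^-1` A) `+` A) <= e.
  move=> mA; rewrite -(@cvg_mu0P _ _ _ mu _ (fun k => mR k _ mA)).
  by split=> [[]|].
have GU A B : G A -> G B -> G (A `|` B).
  move=> GA GB; have [mA _] := GA; have [mB _] := GB.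
  apply/GP => [|e e0]; first exact: measurableU.
  have e20 : 0 < e / 2 by rewrite divr_gt0.
  have [N1 h1] := (GP A mA).1 GA _ e20; have [N2 h2] := (GP B mB).1 GB _ e20.
  exists (maxn N1 N2) => k; rewrite geq_max => /andP[/h1 k1 /h2 k2].
  rewrite (splitr e); apply: le_trans (lerD k1 k2).
  apply: le_trans (PrU _ (mR _ _ mA) (mR _ _ mB)).
  apply: PrS; [exact/mR/measurableU|by apply: measurableU; exact: mR|].
  rewrite /setY /setD => x /=; tauto.
have GbigU (A : nat -> set X) J : (forall j, G (A j)) -> G (\big[setU/set0]_(j < J) A j).
  by move=> GA; elim/big_ind : _ => // j _; exact: GA.
split=> //.
- move=> A [mA hA]; rewrite setTD; split; first exact: measurableC.
  have YC k : (iter (n k) T @^-1` (~` A)) `+` ~` A = (iter (n k) T @^-1` A) `+` A.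
    rewrite preimage_setC; apply/seteqP; rewrite /setY /setD.
    by split=> x /=; case: (pselect (A x)); case: (pselect (A (iter (n k) T x)));
      tauto.
  by under eq_fun do rewrite YC.
- move=> A GA; have mA j : measurable (A j) by case: (GA j).
  have mU : measurable (\bigcup_j A j) by exact: bigcupT_measurable.
  apply/GP => // e e0; have e30 : 0 < e / 3 by rewrite divr_gt0.
  have [J hJ] := Pr_bigcup_tail mu mA e30.
  set U := \bigcup_j A j in mU hJ *.
  have GC := GbigU A J GA; set C := \big[_/_]_(_ < _) _ in GC hJ.
  have [mC _] := GC; have [N hN] := (GP C mC).1 GC _ e30.
  have mUC : measurable (U `\` C) by exact: measurableD.
  exists N => k /hN hk.
  have mUCk := measurable_iter (n k) mUC.
  have CU : C `<=` U.
    rewrite /C /U => x; rewrite -bigcup_mkord => -[j _ Ax]; by exists j.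
  have : Pr mu ((iter (n k) T @^-1` U) `+` U) <=
      Pr mu (((iter (n k) T @^-1` C) `+` C) `|`
              ((iter (n k) T @^-1` (U `\` C)) `|` (U `\` C))).
    apply: PrS; first exact: mR.
      by apply: measurableU; [exact: mR|exact: measurableU].
    rewrite /setY /setD => x /=; have := CU x; have := CU (iter (n k) T x).
    by case: (pselect (C x)); case: (pselect (C (iter (n k) T x))); tauto.
  move/le_trans; apply; apply: le_trans (PrU _ (mR _ _ mC) _) _.
    exact: measurableU.
  have := PrU mu mUCk mUC; rewrite Pr_iter//.
  lra.
Qed.

End Recurrence.

(** * Coverings by sets of small Hamming diameter *)

(** A condition on the finitely many bits [x in B j] cuts out a finite union of
    atoms of the algebra generated by the [B j]. *)
Lemma measurable_names (d : measure_display) (X : measurableType d)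
    (J : finType) (B : J -> set X) (Q : {ffun J -> bool} -> Prop) :
  (forall j, measurable (B j)) ->
  measurable [set x | Q [ffun j => x \in B j]].
Proof.
move=> mB.
have -> : [set x | Q [ffun j => x \in B j]] = \bigcup_(v in [set v | Q v])
    \bigcap_(j in [set: J]) (if v j then B j else ~` B j).
  apply/seteqP; split=> x.
  - move=> /= Qx; exists [ffun j => x \in B j] => //= j _; rewrite ffunE.
    by case: ifPn => [/set_mem|/negP h] //=; move/mem_set.
  - move=> [v /= Qv vx]; rewrite (_ : [ffun _ => _] = v)//.
    apply/ffunP => j; rewrite ffunE; have := vx j I.
    by case: (v j) => [/mem_set//|/= h]; apply/negbTE/negP => /set_mem.
apply: fin_bigcup_measurable => // v _; apply: fin_bigcap_measurable => // j _.
by case: ifP => _ //; exact: measurableC.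
Qed.

Section Coverings.
Variables (R : realType) (d : measure_display) (X : measurableType d).
Variables (mu : probability X R) (T : X -> X).
Variables (r : nat) (P : 'I_r -> set X).

Definition covering (F : {fset nat}) (eps : R) (M : nat) : Prop :=
  exists E : 'I_M -> set X,
    [/\ forall i, measurable (E i),
        forall i, diam R T P F (E i) <= eps &
        ((1 - eps)%:E <= mu (\bigcup_i E i))%E].

Lemma cov_le F (eps : R) M : covering F eps M -> cov mu T P F eps <= M%:R.
Proof.
move=> cM; apply: ge_inf; last by exists M.
by exists 0 => _ [M' _ <-].
Qed.

Lemma covering_mono (F : {fset nat}) (e1 e2 : R) M :
  e1 <= e2 -> covering F e1 M -> covering F e2 M.
Proof.
move=> e12 [E [mE dE UE]]; exists E; split=> // [i|].
- exact: le_trans (dE i) e12.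
- by apply: le_trans UE; rewrite lee_fin lerB.
Qed.

(** [cov] is an infimum of integers, so some admissible cardinality is within
    1 of it, provided that there is one at all. *)
Lemma covering_lt F (eps : R) M : covering F eps M ->
  exists2 M', covering F eps M' & M'%:R < cov mu T P F eps + 1.
Proof.
move=> cM; rewrite /cov.
have hinf : has_inf [set (M%:R : R) | M in covering F eps].
  by split; [exists M%:R, M|exists 0 => _ [M' _ <-]].
have [_ [M' cM' <-] h] := inf_adherent ltr01 hinf.
by exists M'.
Qed.

Lemma part_index_eq x x' : (forall i, (x \in P i) = (x' \in P i)) ->
  part_index P x = part_index P x'.
Proof. by move=> h; apply: eq_pick. Qed.

Lemma part_index_neq x x' i : is_partition P ->
  (x \in P i) != (x' \in P i) -> part_index P x != part_index P x'.
Proof.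
move=> [_ tP UP]; apply: contraNN => /eqP e; apply/eqP.
have index_mem z : exists2 j, part_index P z = Some j & forall k, (z \in P k) = (k == j).
  rewrite /part_index; case: pickP => [j zj|h].
    exists j => // k; apply/idP/eqP => [zk|->//].
    by apply: tP => //; exists z; split; apply: set_mem.
  have [j _ zj] : (\bigcup_i P i) z by rewrite UP.
  by have := h j; rewrite mem_set.
have [j xj xP] := index_mem x; have [j' x'j' x'P] := index_mem x'.
by move: e; rewrite xj x'j' => -[jj']; rewrite xP x'P jj'.
Qed.

Lemma hamming_le1 (F : {fset nat}) x x' : hamming R T P F x x' <= 1.
Proof.
rewrite /hamming; have [F0|F0] := posnP #|` F|.
  by rewrite F0 invr0 mulr0.
rewrite ler_pdivrMr ?ltr0n// mul1r.
apply: (@le_trans _ _ (\sum_(f <- F) 1)).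
  by apply: ler_sum => f _; case: (_ != _).
by rewrite big_const_seq count_predT iter_addr_0.
Qed.

Lemma diam_le (F : {fset nat}) E (eps : R) : 0 <= eps ->
  (forall x x', E x -> E x' -> hamming R T P F x x' <= eps) ->
  diam R T P F E <= eps.
Proof.
move=> eps0 h; rewrite /diam; set S := (S in sup S).
have [->|/set0P S0] := eqVneq S set0; first by rewrite sup0.
by apply: ge_sup => // _ [x Ex [x' Ex' <-]]; exact: h.
Qed.

Lemma hamming_le_diam (F : {fset nat}) E x x' : E x -> E x' ->
  hamming R T P F x x' <= diam R T P F E.
Proof.
move=> Ex Ex'; apply: ub_le_sup; last by exists x => //; exists x'.
by exists 1 => _ [y _ [y' _ <-]]; exact: hamming_le1.
Qed.

(** Sorting the points of [G] by their bits [x in B j] gives at most [2^|J|]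
    pieces.  This is the only source of coverings: the full name along [F]
    shows that they exist, and along the Folner sets built from rigidity times
    a short name is enough. *)
Lemma covering_names (J : finType) (B : J -> set X) (G : set X)
    (F : {fset nat}) (eps : R) :
  (forall j, measurable (B j)) -> measurable G -> 0 <= eps -> 1 - eps <= Pr mu G ->
  (forall x x', G x -> G x' -> (forall j, (x \in B j) = (x' \in B j)) ->
     hamming R T P F x x' <= eps) ->
  covering F eps (2 ^ #|J|).
Proof.
move=> mB mG eps0 PG h.
have <- : #|{: {ffun J -> bool}}| = (2 ^ #|J|)%N by rewrite card_ffun card_bool.
pose E (k : 'I_(#|{: {ffun J -> bool}}|)) :=
  G `&` [set x | [ffun j => x \in B j] = enum_val k].
exists E; split.
- move=> k; apply: measurableI => //.
  exact: (measurable_names (fun v => v = enum_val k) mB).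
- move=> k; apply: diam_le => // x x' [Gx xk] [Gx' x'k]; apply: h => // j.
  by move: xk; rewrite /= -x'k => /ffunP /(_ j); rewrite !ffunE.
- have -> : \bigcup_k E k = G.
    apply/seteqP; split=> [x [k _ []]//|x Gx].
    by exists (enum_rank [ffun j => x \in B j]) => //; split=> //=; rewrite enum_rankK.
  by rewrite PrE// lee_fin.
Qed.

Hypothesis mT : measurable_fun setT T.
Hypothesis PP : is_partition P.

Lemma covering_exists (F : {fset nat}) (eps : R) : 0 < eps ->
  exists M, covering F eps M.
Proof.
move=> eps0; have [mP _ _] := PP.
eexists; apply: (@covering_names (F * 'I_r)%type
  (fun k => iter (fsval k.1) T @^-1` P k.2) setT) => //.
- by move=> k; exact: measurable_iter.
- exact: ltW.
- by rewrite /Pr probability_setT/= gerBl// ltW.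
- move=> x x' _ _ xx'; rewrite /hamming big_seq big1 ?mul0r 1?ltW// => f fF.
  rewrite (_ : part_index P _ = part_index P (iter f T x')) ?eqxx//.
  apply: part_index_eq => i.
  exact: (xx' ([` fF]%fset, i)).
Qed.

End Coverings.

(** * Few pieces force returns *)

(** Markov-type double counting: the pointwise bound is integrated. *)
Lemma Pr_double_count (R : realType) (d : measure_display) (X : measurableType d)
    (mu : probability X R) (I : Type) (s : seq I) (B : I -> set X) (c : R) :
  (forall i, measurable (B i)) ->
  (forall x, \sum_(i <- s) (x \in B i)%:R <= c) ->
  \sum_(i <- s) Pr mu (B i) <= c.
Proof.
move=> mB Bc; rewrite -lee_fin -sumEFin.
have -> : (\sum_(i <- s) (Pr mu (B i))%:E =
    \int[mu]_x (\sum_(i <- s) (\1_(B i) x)%:E))%E.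
  rewrite ge0_integral_sum//.
  - apply: eq_bigr => i _; rewrite integral_indic// setIT; exact/esym/PrE.
  - by move=> i; apply/measurable_EFinP; exact: measurable_indic.
have -> : c%:E = (\int[mu]_x c%:E)%E.
  rewrite integral_cst// (_ : _ setT = 1%E) ?mule1//; exact: probability_setT.
apply: ge0_le_integral => //.
- by move=> x _; apply: sume_ge0 => i _; rewrite lee_fin.
- by apply: emeasurable_sum => i; apply/measurable_EFinP; exact: measurable_indic.
- by move=> x _; rewrite sumEFin lee_fin; apply: le_trans (Bc x).
Qed.

(** More than [K] natural numbers do not fit in a window of length [K]. *)
Lemma spread_of_size (s : seq nat) (K : nat) : uniq s -> (K < size s)%N ->
  exists f g, [/\ f \in s, g \in s & (f + K <= g)%N].
Proof.
move=> us Ks.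
have s0 : exists f, f \in s by case: s Ks {us} => // f s _; exists f; exact: mem_head.
case: (ex_minnP s0) => f fs fmin; exists f.
apply: contrapT => h.
have sub : {subset s <= iota f K}.
  move=> g gs; rewrite mem_iota fmin//= ltnNge; apply/negP => fg.
  by apply: h; exists g.
by have := uniq_leq_size us sub; rewrite size_iota leqNgt Ks.
Qed.

Lemma spread_of_code (C : finType) (code : nat -> C) (s : seq nat) (K : nat) :
  uniq s -> (K * #|C| < size s)%N ->
  exists f g, [/\ f \in s, g \in s, code f = code g & (f + K <= g)%N].
Proof.
move=> us Ks.
have [c Kc] : exists c, (K < size [seq f <- s | code f == c])%N.
  apply: contrapT => h.
  have : (size s <= \sum_(c : C) K)%N.
    rewrite -sum1_size (partition_big code predT)//=; apply: leq_sum => c _.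
    rewrite sum1_count -size_filter leqNgt; apply/negP => Kc; apply: h.
    by exists c.
  by rewrite sum_nat_const mulnC leqNgt Ks.
have [f [g [+ + fg]]] := spread_of_size (filter_uniq _ us) Kc.
rewrite !mem_filter => /andP[/eqP fc fs] /andP[/eqP gc gs].
by exists f, g; rewrite fc gc.
Qed.

Section Returns.
Variables (R : realType) (d : measure_display) (X : measurableType d).
Variables (mu : probability X R) (T : X -> X).
Hypothesis mT : measurable_fun setT T.
Hypothesis muT : forall A, measurable A -> mu (T @^-1` A) = mu A.
Variables (r : nat) (P : 'I_r -> set X) (i0 : 'I_r).
Hypothesis PP : is_partition P.
Let A := P i0.

(** Write [code f] for the pattern of [T^f c in A] over the centres [c] of the
    pieces.  The Hamming bound, summed over [F], says that for at least half of
    the [f] the event [T^f x in A] is predicted by [code f] and the piece of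
    [x], outside a set of measure [2 eps].  Two such times with equal codes
    give sets [T^-f A] and [T^-g A] that differ by at most [5 eps], of which
    [eps] comes from the uncovered points. *)
Lemma covering_return (F : {fset nat}) (eps : R) (M K : nat) : 0 < eps ->
  covering mu T P F eps M -> (K * 2 ^ M * 2 < #|` F|)%N ->
  exists2 m, (K <= m)%N & Pr mu ((iter m T @^-1` A) `+` A) <= 5 * eps.
Proof.
move=> eps0 [E [mE dE UE]] FK.
have mA : measurable A by case: PP => mP _ _; exact: mP.
pose U := \bigcup_i E i.
have mU : measurable U.
  by apply: fin_bigcup_measurable.
pose center (j : 'I_M) : X := get (E j).
pose idx (x : X) := [pick j | x \in E j].
pose code (f : nat) : {ffun 'I_M -> bool} := [ffun j => iter f T (center j) \in A].
(* the covered points at which the prediction for time f fails *)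
pose bad (f : nat) : set X := [set x | if idx x is Some j then
   (iter f T x \in A) != code f j else False].
have mbad f : measurable (bad f).
  pose B (j : option 'I_M) := if j is Some j then E j else iter f T @^-1` A.
  pose Q (v : {ffun option 'I_M -> bool}) : Prop :=
    if [pick j | v (Some j)] is Some j then v None != code f j else False.
  have mB j : measurable (B j).
    by case: j => [j|]; [exact: mE|exact: measurable_iter].
  have QE x : Q [ffun j => x \in B j] = bad f x.
    rewrite /Q (_ : [pick j | _] = idx x) ?ffunE//.
    by apply: eq_pick => j; rewrite ffunE.
  have := measurable_names Q mB; rewrite (_ : [set x | Q _] = bad f)//.
  by apply/seteqP; split => x /=; rewrite QE.
have sumbad : \sum_(f <- F) Pr mu (bad f) <= eps * #|` F|%:R.
  apply: Pr_double_count => // x.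
  case xj : (idx x) => [j|]; last first.
    rewrite big1 ?mulr_ge0 ?(ltW eps0)// => f _; rewrite memNset//.
    by rewrite /bad /= xj.
  have Ex : E j x.
    by move: xj; rewrite /idx; case: pickP => // j' /set_mem ? [<-].
  have Ec : E j (center j) by apply: getPex; exists x.
  have := le_trans (hamming_le_diam R T P F Ex Ec) (dE j).
  rewrite /hamming ler_pdivrMr ?ltr0n; last by case: #|` F| FK.
  apply: le_trans; apply: ler_sum => f _.
  case: (boolP (x \in bad f)) => [/set_mem|_]; last by rewrite ler0n.
  rewrite /bad/= xj ffunE => xA.
  by rewrite (part_index_neq PP xA).
pose good := [seq f <- F | Pr mu (bad f) <= 2 * eps].
(* by Markov, at most half of the times have a bad set above 2 eps *)
have sgood : (K * #|{: {ffun 'I_M -> bool}}| < size good)%N.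
  rewrite card_ffun card_bool card_ord.
  pose ngood := [seq f <- F | ~~ (Pr mu (bad f) <= 2 * eps)].
  have szF : (size good + size ngood = #|` F|)%N.
    by rewrite !size_filter count_predC.
  have : (2 * eps) * (size ngood)%:R <= eps * #|` F|%:R.
    apply: le_trans sumbad.
    rewrite (bigID (fun f => Pr mu (bad f) <= 2 * eps))/=.
    apply: (@le_trans _ _ (\sum_(f <- F | ~~ (Pr mu (bad f) <= 2 * eps)) 2 * eps)).
      by rewrite big_const_seq iter_addr_0 size_filter mulr_natr.
    rewrite ler_wpDl//; first by apply: sumr_ge0 => f _; exact: Pr_ge0.
    by apply: ler_sum => f; rewrite -ltNge => /ltW.
  rewrite -mulrA mulrCA ler_pM2l// -natrM ler_nat => h.
  lia.
have ug : uniq good by rewrite filter_uniq ?fset_uniq.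
have [f [g [+ + cfg fg]]] := spread_of_code code ug sgood.
rewrite !mem_filter => /andP[bf _] /andP[bg _].
exists (g - f)%N; first by lia.
(* by invariance the return is measured after pulling back by T^f *)
have mR := measurable_return mT (g - f) mA.
rewrite -(Pr_iter mT muT f mR).
have mfR := measurable_iter mT f mR.
have sub : iter f T @^-1` ((iter (g - f) T @^-1` A) `+` A) `<=`
   ~` U `|` (bad f `|` bad g).
  move=> x; have [Ux|?] := pselect (U x); last by left.
  move=> xA; right; apply: contrapT => xb.
  have gE : iter (g - f) T (iter f T x) = iter g T x.
    by rewrite -iterD subnK//; lia.
  have [j xj] : exists j, idx x = Some j.
    rewrite /idx; case: pickP => [j _|h]; first by exists j.
    by have [j _ xj] := Ux; have := h j; rewrite mem_set.
  have nb h : ~ bad h x -> (iter h T x \in A) = code h j.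
    by rewrite /bad /= xj => /negP; rewrite negbK => /eqP.
  have fgA : (iter f T x \in A) = (iter g T x \in A).
    by rewrite !nb ?cfg// => b; apply: xb; [right|left].
  move: xA; rewrite /setY /setD /= gE => -[[gA nfA]|[fA ngA]].
  - by apply: nfA; apply: set_mem; rewrite fgA mem_set.
  - by apply: ngA; apply: set_mem; rewrite -fgA mem_set.
have mUb : measurable (~` U) by exact: measurableC.
have mbb : measurable (bad f `|` bad g) by exact: measurableU.
apply: le_trans (PrS mu mfR (measurableU _ _ mUb mbb) sub) _.
apply: le_trans (PrU mu mUb mbb) _.
have := PrU mu (mbad f) (mbad g).
have : Pr mu (~` U) <= eps.
  by rewrite PrC//; move: UE; rewrite PrE// lee_fin; lra.
move: bf bg; lra.
Qed.

End Returns.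

(** * Sublogarithmic coverings produce a rigidity sequence *)

Lemma limn_esup_lt (R : realType) (u : nat -> \bar R) (c : \bar R) :
  (limn_esup u < c)%E -> exists N, forall n, (N <= n)%N -> (u n < c)%E.
Proof.
rewrite limn_esup_lim (cvg_lim _ (@cvg_esups_inf _ u))// => /ereal_inf_lt[_ [N _ <-] uc].
exists N => n Nn; apply: le_lt_trans uc.
by apply: ereal_sup_ubound; exists n.
Qed.

Lemma limn_esup_le (R : realType) (u : nat -> \bar R) (c : \bar R) :
  (exists N, forall n, (N <= n)%N -> (u n <= c)%E) -> (limn_esup u <= c)%E.
Proof.
move=> [N uc]; rewrite limn_esup_lim (cvg_lim _ (@cvg_esups_inf _ u))//.
apply: (@le_trans _ _ (esups u N)); first by apply: ereal_inf_lbound; exists N.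
by apply: ge_ereal_sup => _ [k Nk <-]; exact: uc.
Qed.

(** A nonempty finite set of natural numbers is never contained in its
    translate by 1, because of its minimum; so at least one point is lost, a
    proportion that is bounded below if the cardinality is bounded. *)
Lemma folner_card_infty (R : realType) (F : nat -> {fset nat}) : folner R F ->
  forall K : nat, exists N, forall n, (N <= n)%N -> (K < #|` F n|)%N.
Proof.
move=> [F0 cvgF] K.
have K0 : 0 < (K.+1%:R^-1 : R) by rewrite invr_gt0.
have /cvgrPdist_lt/(_ _ K0)[N _ hN] := cvgF 1%N.
exists N => n /hN; set a := #|` _|; set c := #|` F n| => /=.
have ac : (a < c)%N.
  apply: fproper_ltn_card; rewrite fproperE fsubsetIr/=.
  have /fset0Pn exF := F0 n; case: (ex_minnP exF) => m mF mmin.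
  apply/negP => /fsubsetP /(_ _ mF); rewrite inE => /andP[/imfsetP[f /= fF mf] _].
  by have := mmin _ fF; rewrite mf addn1 ltnn.
move=> h; rewrite ltnNge; apply/negP => cK.
have c0 : 0 < (c%:R : R) by rewrite ltr0n; exact: leq_ltn_trans ac.
have h1 : (a%:R / c%:R : R) <= 1 - K.+1%:R^-1.
  have hc : (K.+1%:R^-1 * c%:R : R) <= 1 by rewrite ler_pdivrMl// mulr1 ler_nat ltnW.
  have ha : (a%:R + 1 : R) <= c%:R by rewrite natr1 ler_nat.
  by rewrite ler_pdivrMr// mulrBl mul1r lerBrDr (le_trans _ ha)// lerD2l.
have h2 : (K.+1%:R^-1 : R) <= 1 - a%:R / c%:R by rewrite lerBrDr addrC -lerBrDr.
by move: h; rewrite ger0_norm ?(le_trans (ltW K0) h2)// ltNge h2.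
Qed.

Lemma expn_lt_of_ln (R : realType) (K M c : nat) (x : R) : (0 < c)%N ->
  x = ln (c%:R) -> 2 * (1 + ln ((K.+1).*2%:R)) <= x -> M%:R < x / 2 + 1 ->
  (K.+1 * 2 ^ M * 2 < c)%N.
Proof.
move=> c0 -> hK hM.
rewrite -(ltr_nat R) -ltr_ln ?posrE ?ltr0n ?muln_gt0 ?expn_gt0//.
rewrite mulnAC muln2 natrM lnM ?posrE ?ltr0n ?expn_gt0// natrX lnXn ?ltr0n//.
have ln2 : ln (2%:R : R) <= 1.
  by rewrite -[2%:R](natrD R 1 1); apply: le_ln1Dx.
have : ln 2%:R *+ M <= (M%:R : R).
  by rewrite -[leLHS]mulr_natr ler_piMl.
lra.
Qed.

Section RigidTimes.
Variables (R : realType) (d : measure_display) (X : measurableType d).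
Variables (mu : probability X R) (T : X -> X).
Hypothesis mT : measurable_fun setT T.
Hypothesis muT : forall A, measurable A -> mu (T @^-1` A) = mu A.
Variables (r : nat) (P : 'I_r -> set X) (F : nat -> {fset nat}).
Hypothesis PP : is_partition P.
Hypothesis folF : folner R F.
Hypothesis slow0 : (h_slow mu T (fun n : nat => ln (n%:R : R)) F P <= 0)%E.

(** The constant 1/2 makes [2^M] at most of the order of [|F|^(1/2)]. *)
Lemma small_covering (eps : R) (K : nat) : 0 < eps ->
  exists n M, covering mu T P (F n) eps M /\ (K.+1 * 2 ^ M * 2 < #|` F n|)%N.
Proof.
move=> eps0.
have lim0 : (limn_esup (fun n => (cov mu T P (F n) eps / ln #|` F n|%:R)%:E)
    < (2^-1)%:E)%E.
  apply: le_lt_trans (_ : (0 < _)%E); last by rewrite lte_fin invr_gt0.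
  by apply: le_trans slow0; apply: ereal_sup_ubound; exists eps.
have [N1 hN1] := limn_esup_lt lim0.
pose x0 : R := 2 * (1 + ln ((K.+1).*2%:R)).
have [N2 hN2] := folner_card_infty folF (Num.truncn (expR x0)).
pose n := maxn N1 N2; have := hN1 n (leq_maxl _ _).
have [M0 cM0] := covering_exists mu mT PP (F n) eps0.
have [M cM hM] := covering_lt cM0.
have cF : expR x0 < #|` F n|%:R.
  apply: lt_le_trans (truncnS_gt _) _.
  by rewrite ler_nat; apply: hN2; exact: leq_maxr.
have F0 : (0 < #|` F n|)%N.
  by rewrite -(ltr_nat R); apply: lt_trans cF; exact: expR_gt0.
have x0F : x0 < ln #|` F n|%:R.
  by rewrite -ltr_expR lnK// posrE ltr0n.
have lnF0 : 0 < ln #|` F n|%:R :> R.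
  apply: lt_trans x0F; rewrite /x0.
  have : 0 <= ln ((K.+1).*2%:R : R).
    by rewrite ln_ge0// ler1n double_gt0.
  lra.
rewrite lte_fin ltr_pdivrMr// => covF.
exists n, M; split=> //.
apply: (expn_lt_of_ln (R := R) F0 erefl); first exact: ltW.
by move: hM covF; rewrite mulrC; lra.
Qed.

Lemma small_returns (i0 : 'I_r) (e : R) (K : nat) : 0 < e ->
  exists2 m, (K <= m)%N & Pr mu ((iter m T @^-1` P i0) `+` P i0) <= e.
Proof.
move=> e0; have e50 : 0 < e / 5 by rewrite divr_gt0.
have [n [M [cM hM]]] := small_covering K e50.
have [m Km Pm] := covering_return mT muT i0 PP e50 cM hM.
by exists m; [exact: ltnW|rewrite (le_trans Pm)// mulrC divfK].
Qed.

Lemma rigidity_times (i0 : 'I_r) : exists n : nat -> nat,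
  [/\ n 0%N = 0%N, forall i j, (i < j)%N -> (n i < n j)%N &
      mu ((iter (n k) T @^-1` P i0) `+` P i0) @[k --> \oo] --> 0%E].
Proof.
have /choice[g gP] : forall kK : nat * nat, exists m, (kK.2 <= m)%N /\
    Pr mu ((iter m T @^-1` P i0) `+` P i0) <= kK.1.+1%:R^-1.
  move=> [k K]; have k0 : 0 < (k.+1%:R^-1 : R) by rewrite invr_gt0.
  by have [m Km Pm] := small_returns i0 K k0; exists m.
pose fix n (k : nat) : nat := if k is k'.+1 then g (k', (n k').+1) else 0%N.
have mP : measurable (P i0) by case: PP => mP _ _; exact: mP.
exists n; split=> //.
- apply: (@homo_ltn _ n (fun a b => a < b)%N) => [? ? ?|k]; first exact: ltn_trans.
  by have [] := gP (k, (n k).+1).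
- apply/cvg_mu0P => [k|e e0]; first exact: measurable_return.
  exists (Num.truncn e^-1).+1 => -[//|k] ek.
  have [_ /le_trans] := gP (k, (n k).+1); apply => /=.
  rewrite invf_ple ?posrE// ltW// (lt_le_trans (truncnS_gt _))//.
  by rewrite ler_nat.
Qed.

End RigidTimes.

(** * The factor generated by a set *)

(** The itinerary of [x] in [A] under all integer powers of [T] intertwines [T]
    with the shift; its law makes the shift a factor in which the coordinate 0
    plays the role of [A]. *)
Section BinaryFactor.
Variables (R : realType) (d : measure_display) (X : measurableType d).
Variables (mu : probability X R) (T T' : X -> X).
Hypothesis mT : measurable_fun setT T.
Hypothesis mT' : measurable_fun setT T'.
Hypotheses (TK : cancel T T') (T'K : cancel T' T).
Hypothesis muT : forall A, measurable A -> mu (T @^-1` A) = mu A.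

Let muT' A : measurable A -> mu (T' @^-1` A) = mu A.
Proof.
move=> mA; have mT'A : measurable (T' @^-1` A).
  by rewrite -[X in measurable X]setTI; exact: mT'.
rewrite -(muT mT'A); congr (mu _).
by apply/seteqP; split=> x /=; rewrite TK.
Qed.

Definition ziter (i : int) : X -> X :=
  match i with Posz n => iter n T | Negz n => iter n.+1 T' end.

Lemma ziter_step i x : ziter i (T x) = ziter (i + 1) x.
Proof.
case: i => [n|[|n]].
- by rewrite -PoszD addn1 /ziter -iterSr.
- by rewrite /= TK.
- have -> : Negz n.+1 + 1 = Negz n by lia.
  by rewrite /ziter iterSr TK.
Qed.

Lemma ziter_comm i x : ziter i (T x) = T (ziter i x).
Proof.
case: i => n; first by rewrite /ziter -iterSr -iterS.
by rewrite /ziter iterSr TK iterS T'K.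
Qed.

Lemma ziter_iter i n x : ziter i (iter n T x) = iter n T (ziter i x).
Proof. by elim: n x => // n IH x; rewrite !iterS ziter_comm IH. Qed.

Lemma measurable_ziter i A : measurable A -> measurable (ziter i @^-1` A).
Proof. by case: i => n; exact: measurable_iter. Qed.

Lemma Pr_ziter i A : measurable A -> Pr mu (ziter i @^-1` A) = Pr mu A.
Proof. by case: i => n; exact: Pr_iter. Qed.

Variable A : set X.
Hypothesis mA : measurable A.

Definition itinerary (x : X) : binseq_borel R := fun i => ziter i x \in A.

Definition shift (y : binseq_borel R) : binseq_borel R := fun i => y (i + 1).

Lemma itinerary_shift x : itinerary (T x) = shift (itinerary x).
Proof. by apply/funext => i; rewrite /itinerary /shift ziter_step. Qed.

Lemma itinerary_iter n x : itinerary (iter n T x) = iter n shift (itinerary x).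
Proof. by elim: n => // n IH; rewrite !iterS itinerary_shift IH. Qed.

Lemma measurable_coordinate i : measurable [set y : binseq_borel R | y i].
Proof. by apply: sub_sigma_algebra; exact: open_coordinate. Qed.

Lemma measurable_binseq d' (Z : measurableType d') (f : Z -> binseq_borel R) :
  (forall i, measurable [set z | f z i]) -> measurable_fun setT f.
Proof.
move=> mf _ B mB; rewrite setTI.
apply: (@borel_binseq_ind R [set B | measurable (f @^-1` B)]) mB => //.
split=> /=.
- by rewrite preimage_set0.
- by move=> C mC; rewrite setTD preimage_setC; exact: measurableC.
- by move=> C mC; rewrite preimage_bigcup; exact: bigcupT_measurable.
Qed.

Lemma preimage_coordinate i :
  itinerary @^-1` [set y : binseq_borel R | y i] = ziter i @^-1` A.
Proof.
apply/seteqP; split=> x; rewrite /itinerary /=; first by move=> /set_mem.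
by move=> xA; rewrite mem_set.
Qed.

Lemma measurable_itinerary : measurable_fun setT itinerary.
Proof.
apply: measurable_binseq => i.
by have := measurable_ziter i mA; rewrite -preimage_coordinate.
Qed.

HB.instance Definition _ :=
  isMeasurableFun.Build _ _ _ _ itinerary measurable_itinerary.

Definition itinerary_law : probability (binseq_borel R) R :=
  distribution mu itinerary.

Lemma itinerary_lawE B : itinerary_law B = mu (itinerary @^-1` B).
Proof. by []. Qed.

Lemma mp_system_itinerary : mp_system itinerary_law shift.
Proof.
split; first exact: standard_borel_binseq.
split.
- by apply: measurable_binseq => i; exact: measurable_coordinate.
- exists (fun y i => y (i - 1)).
    by apply: measurable_binseq => i; exact: measurable_coordinate.
  by split=> y; apply/funext => i; rewrite /shift ?subrK ?addrK.
- move=> B mB; have mIB : measurable (itinerary @^-1` B).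
    by rewrite -[X in measurable X]setTI; exact (measurable_itinerary measurableT mB).
  rewrite !itinerary_lawE -[RHS]muT//.
  by congr (mu _); apply/seteqP; split=> x /=; rewrite itinerary_shift.
Qed.

Lemma is_factor_itinerary : is_factor mu T itinerary_law shift.
Proof.
exists itinerary; split=> //.
by apply: aeW => x; exact: itinerary_shift.
Qed.

(** The coordinate [i] pulls back to [T^-i A], whose returns have the same
    measure as those of [A]; the remaining Borel sets follow since rigid sets
    form a sigma-algebra. *)
Lemma rigid_itinerary (n : nat -> nat) : n 0%N = 0%N ->
  (forall i j, (i < j)%N -> (n i < n j)%N) ->
  mu ((iter (n k) T @^-1` A) `+` A) @[k --> \oo] --> 0%E ->
  rigid itinerary_law shift.
Proof.
move=> n0 nlt nA; exists n; split=> // B mB.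
have [_ [mS _ nuS]] := mp_system_itinerary.
have sG := recurrent_sigma_algebra mS nuS n.
suff /(borel_binseq_ind sG)/(_ _ mB)[] : forall i,
    measurable [set y : binseq_borel R | y i] /\
    itinerary_law ((iter (n k) shift @^-1` [set y | y i]) `+` [set y | y i])
      @[k --> \oo] --> 0%E by [].
move=> i; split; first exact: measurable_coordinate.
suff h k : itinerary_law ((iter (n k) shift @^-1` [set y | y i]) `+` [set y | y i])
    = mu ((iter (n k) T @^-1` A) `+` A).
  by under eq_fun do rewrite h.
rewrite itinerary_lawE.
have -> : itinerary @^-1`
    ((iter (n k) shift @^-1` [set y : binseq_borel R | y i]) `+` [set y | y i]) =
    ziter i @^-1` ((iter (n k) T @^-1` A) `+` A).
  have pE x : [set y : binseq_borel R | y i] (itinerary x) = A (ziter i x).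
    have := congr1 (fun D : set X => D x) (preimage_coordinate i).
    by [].
  apply/seteqP; split=> x; rewrite /setY /setD /= -itinerary_iter;
    by have := pE x; have := pE (iter (n k) T x); rewrite /= ziter_iter => -> ->.
have mR := measurable_return mT (n k) mA.
by rewrite !PrE ?Pr_ziter//; exact: measurable_ziter.
Qed.

Lemma itinerary_nontrivial : 0 < Pr mu A -> Pr mu A < 1 ->
  ~ trivial_system itinerary_law.
Proof.
move=> A0 A1 [y0 [N [mN N0 yN]]].
pose C := [set y : binseq_borel R | y 0].
have mC : measurable C by exact: measurable_coordinate.
have PC : Pr itinerary_law C = Pr mu A.
  by rewrite /Pr itinerary_lawE preimage_coordinate.
have PN : Pr itinerary_law N = 0 by rewrite /Pr N0.
case y00 : (y0 0).
- have : Pr itinerary_law (~` C) <= Pr itinerary_law N.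
    apply: PrS => //; first exact: measurableC.
    by move=> y Cy; apply: yN => yy0; apply: Cy; rewrite /C /= yy0.
  by rewrite PrC// PC PN; lra.
- have : Pr itinerary_law C <= Pr itinerary_law N.
    apply: PrS => // y Cy; apply: yN => yy0.
    by move: Cy; rewrite /C /= yy0 y00.
  by rewrite PC PN; lra.
Qed.

End BinaryFactor.

(** * Nontrivial standard Borel systems have sets of intermediate measure *)

(** Totality of [dn] avoids the case of an empty [D]: indices that correspond
    to no point of [D] receive an arbitrary value. *)
Lemma separable_seq (U : pointedType) (D : set U) : countable D ->
  exists dn : nat -> U, D `<=` range dn.
Proof.
move=> /countable_injP[g /= gI].
exists (fun n => get [set x | D x /\ g x = n]) => x Dx.
have [] := @getPex _ [set y | D y /\ g y = g x] (ex_intro _ x (conj Dx erefl)).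
set y := get _ => Dy gyx; exists (g x) => //.
by apply: gI => //; exact: mem_set.
Qed.

Lemma setT_not_negligible (R : realType) (d : measure_display)
    (Y : measurableType d) (nu : probability Y R) : ~ nu.-negligible setT.
Proof.
move=> /(negligibleP nu measurableT) nuT0.
have := probability_setT nu; rewrite /= nuT0 => /eqP.
by rewrite eq_sym onee_eq0.
Qed.

(** For each radius, countably many balls cover the space, so one of them has
    full measure.  The intersection of these over a sequence of radii tending
    to 0 has full measure and diameter 0, hence is a point. *)
Lemma zero_one_trivial (R : realType) (d : measure_display)
    (Y : measurableType d) (nu : probability Y R) :
  standard_borel R Y ->
  (forall A, measurable A -> Pr nu A = 0 \/ Pr nu A = 1) ->
  trivial_system nu.
Proof.
move=> [U [f [hU [D /separable_seq[dn Ddn] dD] [g fK gK] mY]]] h01.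
have mf O : open O -> measurable (f @^-1` O).
  move=> oO; apply/mY; rewrite image_preimage; first exact: sub_sigma_algebra.
  by apply/seteqP; split=> // x _; exists (g x).
pose e (k : nat) : R := k.+1%:R^-1.
have e0 k : 0 < e k by rewrite invr_gt0.
pose B k n := f @^-1` (ball (dn n) (e k))°.
have mB k n : measurable (B k n) by apply: mf; exact: open_interior.
have /choice[nk hnk] : forall k, exists n, Pr nu (B k n) = 1.
  move=> k; apply: contrapT => h.
  have B0 n : nu (B k n) = 0%E.
    rewrite PrE//; have [-> //|P1] := h01 _ (mB k n).
    by exfalso; apply: h; exists n.
  have BT : \bigcup_n B k n = setT.
    apply/seteqP; split=> // y _.
    have ek20 : 0 < e k / 2 by rewrite divr_gt0.
    have [x [xy Dx]] : (ball (f y) (e k / 2))° `&` D !=set0.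
      apply: dD; last exact: open_interior.
      by exists (f y); apply: nbhs_singleton; apply: nbhs_interior; exact: nbhsx_ballx.
    have [n _ dnx] := Ddn _ Dx.
    exists n => //; rewrite /B /= dnx; apply/nbhs_ballP; exists (e k / 2) => // z yz.
    rewrite (splitr (e k)); apply: ball_triangle yz; apply: ball_sym.
    exact: interior_subset xy.
  have : nu.-negligible (\bigcup_n B k n).
    by apply: negligible_bigcup => n; exact/(negligibleP _ (mB k n))/B0.
  by rewrite BT; exact: setT_not_negligible.
pose N := \bigcup_k ~` B k (nk k).
have N0 : nu.-negligible N.
  apply: negligible_bigcup => k; apply/(negligibleP _ (measurableC (mB _ _))).
  by have := PrE nu (measurableC (mB k (nk k))); rewrite PrC// hnk subrr.
have [y0 Ny0] : exists y0, ~ N y0.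
  apply: contrapT => h; have NT : N = setT.
    apply/seteqP; split=> // y _; apply: contrapT => Ny; by apply: h; exists y.
  by move: N0; rewrite NT; exact: setT_not_negligible.
exists y0; apply: negligibleS N0 => y /= yy0; apply: contrapT => Ny; apply: yy0.
have inB z k : ~ N z -> ball (dn (nk k)) (e k) (f z).
  move=> Nz; apply: contrapT => h; apply: Nz; exists k => //= Bz.
  by apply: h; exact: interior_subset Bz.
apply: (can_inj fK); apply: hU => A C /nbhs_ballP[r /= r0 rA] nC.
exists (f y0); split; last exact: nbhs_singleton nC.
apply: rA; pose k := Num.truncn (2 / r).
apply: (@le_ball _ _ _ (e k + e k)); last first.
  by apply: ball_triangle (inB _ k Ny0); apply: ball_sym; exact: inB.
rewrite -mulr2n -mulr_natl /e ler_pdivrMr ?ltr0n//.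
by rewrite -ler_pdivrMl// mulrC ltW// truncnS_gt.
Qed.

Lemma nontrivial_set (R : realType) (d : measure_display)
    (Y : measurableType d) (nu : probability Y R) :
  standard_borel R Y -> ~ trivial_system nu ->
  exists A, [/\ measurable A, 0 < Pr nu A & Pr nu A < 1].
Proof.
move=> sY nY; apply: contrapT => h; apply/nY/zero_one_trivial => // A mA.
have P1 : Pr nu A <= 1 by rewrite -lee_fin -PrE//; exact: probability_le1.
have P0 := Pr_ge0 nu A.
have [->|A0] := eqVneq (Pr nu A) 0; first by left.
have [->|A1] := eqVneq (Pr nu A) 1; first by right.
by exfalso; apply: h; exists A; split=> //; rewrite lt_neqAle ?P0 ?P1 ?A1 ?andbT// eq_sym.
Qed.

(** * Pulling back rigidity from a factor *)

Section PullBack.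
Variables (R : realType) (d d' : measure_display).
Variables (X : measurableType d) (mu : probability X R) (T : X -> X).
Variables (Y : measurableType d') (nu : probability Y R) (S : Y -> Y).
Hypothesis mT : measurable_fun setT T.
Hypothesis muT : forall A, measurable A -> mu (T @^-1` A) = mu A.
Hypothesis mS : measurable_fun setT S.

(** The intertwining relation holds outside a null set only; its iterates hold
    outside the union of the preimages of this null set. *)
Lemma factor_iter (pi : X -> Y) (m : nat) :
  {ae mu, forall x, pi (T x) = S (pi x)} ->
  exists N, [/\ measurable N, mu N = 0%E &
    forall x, ~ N x -> pi (iter m T x) = iter m S (pi x)].
Proof.
move=> [N1 [mN1 N10 hN1]].
have {}hN1 x : ~ N1 x -> pi (T x) = S (pi x).
  by move=> Nx; apply: contrapT => h; apply: Nx; exact: hN1.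
elim: m => [|m [N [mN N0 hN]]]; first by exists set0; split=> //; rewrite measure0.
have mTN : measurable (T @^-1` N) by exact: (measurable_iter mT 1).
have TN0 : mu (T @^-1` N) = 0%E by rewrite muT.
exists (N1 `|` T @^-1` N); split.
- exact: measurableU.
- by rewrite measureU0.
- move=> x /not_orP[x1 x2].
  by rewrite !iterSr (hN _ x2) hN1.
Qed.

Lemma rigid_pullback (n : nat -> nat) (pi : X -> Y) (A : set Y) :
  measurable_fun setT pi ->
  (forall A, measurable A -> mu (pi @^-1` A) = nu A) ->
  {ae mu, forall x, pi (T x) = S (pi x)} -> measurable A ->
  nu ((iter (n k) S @^-1` A) `+` A) @[k --> \oo] --> 0%E ->
  mu ((iter (n k) T @^-1` (pi @^-1` A)) `+` (pi @^-1` A)) @[k --> \oo] --> 0%E.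
Proof.
move=> mpi mupi piTS mA nA.
have mpiI (B : set Y) : measurable B -> measurable (pi @^-1` B).
  by move=> mB; rewrite -[X in measurable X]setTI; exact: mpi.
pose RA k := (iter (n k) S @^-1` A) `+` A.
pose RB k := (iter (n k) T @^-1` (pi @^-1` A)) `+` (pi @^-1` A).
have mRA k : measurable (RA k) := measurable_return mS (n k) mA.
have mRB k : measurable (RB k) := measurable_return mT (n k) (mpiI _ mA).
apply/(cvg_mu0P mu mRB) => e e0.
have [N hN] := (cvg_mu0P nu mRA).1 nA e e0; exists N => k /hN.
apply: le_trans.
have [Z [mZ Z0 hZ]] := factor_iter (n k) piTS.
have -> : Pr nu (RA k) = Pr mu (pi @^-1` RA k) + Pr mu Z.
  by rewrite /Pr mupi// Z0 addr0.
have mRAk := mpiI _ (mRA k).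
apply: le_trans (PrU mu mRAk mZ); apply: PrS => //; first exact: measurableU.
move=> x xB; have [?|/hZ xZ] := pselect (Z x); first by right.
by left; move: xB; rewrite /RA /RB /setY /setD /= xZ.
Qed.

End PullBack.

(** * Long Følner sets with few names *)

Section Blocks.
Variable m : nat -> nat.

Definition blocks (K N : nat) : {fset nat} :=
  [fset f in [seq (m i + j)%N | i <- iota 0 K, j <- iota 0 N]]%fset.

Lemma blocksP (K N f : nat) :
  reflect (exists i j, [/\ (i < K)%N, (j < N)%N & f = (m i + j)%N]) (f \in blocks K N).
Proof.
rewrite inE; apply: (iffP allpairsP) => [[[i j] /= [iK jN ->]]|[i [j [iK jN ->]]]].
- by exists i, j; move: iK jN; rewrite !mem_iota.
- by exists (i, j); rewrite !mem_iota.
Qed.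

Variable N : nat.
Hypothesis m_gap : forall i i', (i < i')%N -> (m i + N <= m i')%N.

Lemma card_blocks (K : nat) : #|` blocks K N| = (K * N)%N.
Proof.
rewrite card_fseq undup_id; first by rewrite size_allpairs !size_iota.
apply: allpairs_uniq; rewrite ?iota_uniq//.
move=> _ _ /allpairsP[[i j] /= [_ jN ->]] /allpairsP[[i' j'] /= [_ j'N ->]] /= e.
move: jN j'N; rewrite !mem_iota /= add0n => jN j'N.
have [ii'|ii'|ii'] := ltngtP i i'.
- by have := m_gap ii'; lia.
- by have := m_gap ii'; lia.
- by congr pair => //; move: e; rewrite ii'; lia.
Qed.

(** A translation by [k] only loses the first [k] points of each interval. *)
Lemma blocks_shift (K k : nat) :
  (K * N <= #|` ([fset (f + k)%N | f in blocks K N] `&` blocks K N)%fset| + K * k)%N.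
Proof.
rewrite -card_blocks.
set A := (_ `&` _)%fset.
have sub : (blocks K N `<=` A `|` blocks K k)%fset.
  apply/fsubsetP => f fB; rewrite inE inE fB andbT; apply/orP.
  have /blocksP[i [j [iK jN ->]]] := fB.
  have [jk|kj] := ltnP j k; first by right; apply/blocksP; exists i, j.
  left; apply/imfsetP; exists (m i + (j - k))%N; last by lia.
  by apply/blocksP; exists i, (j - k)%N; split=> //; lia.
have := fsubset_leq_card sub; have := cardfsUI A (blocks K k).
have : (#|` blocks K k| <= K * k)%N.
  rewrite card_fseq (leq_trans (size_undup _))//.
  by rewrite size_allpairs !size_iota.
lia.
Qed.

End Blocks.

Lemma folner_blocks (R : realType) (F : nat -> {fset nat}) (K : nat -> nat) :
  (forall N, (0 < K N)%N) ->
  (forall N, #|` F N| = (K N * N.+1)%N) ->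
  (forall N k, (#|` F N| <=
     #|` ([fset (f + k)%N | f in F N] `&` F N)%fset| + K N * k)%N) ->
  folner R F.
Proof.
move=> K0 cF sF; split=> [N|k].
  by rewrite -cardfs_gt0 cF muln_gt0 K0.
apply/cvgrPdist_le => e e0.
exists (Num.truncn (k%:R / e)) => // N /= kN.
have := sF N k; set a := #|` (_ `&` _)%fset|; rewrite cF => ha.
have ac : (a <= K N * N.+1)%N.
  by rewrite -cF; apply: fsubset_leq_card; exact: fsubsetIr.
have c0 : 0 < ((K N * N.+1)%:R : R) by rewrite ltr0n muln_gt0 K0.
rewrite ger0_norm; last by rewrite subr_ge0 ler_pdivrMr// mul1r ler_nat.
rewrite lerBlDr -lerBlDl ler_pdivlMr//.
have keN : k%:R <= e * N.+1%:R.
  rewrite mulrC -ler_pdivrMr// (le_trans (ltW (truncnS_gt _)))//.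
  by rewrite ler_nat.
have KkeN : (K N)%:R * k%:R <= e * (K N * N.+1)%:R.
  by rewrite natrM mulrCA ler_pM2l// ltr0n.
have : ((K N * N.+1)%:R : R) <= a%:R + (K N)%:R * k%:R.
  by rewrite -natrM -natrD ler_nat.
by rewrite mulrBl mul1r; lra.
Qed.

Section RigidSet.
Variables (R : realType) (d : measure_display) (X : measurableType d).
Variables (mu : probability X R) (T : X -> X).
Hypothesis mT : measurable_fun setT T.
Hypothesis muT : forall A, measurable A -> mu (T @^-1` A) = mu A.
Variables (B : set X) (n : nat -> nat).
Hypothesis mB : measurable B.
Hypothesis nlt : forall i j, (i < j)%N -> (n i < n j)%N.
Hypothesis nB : mu ((iter (n k) T @^-1` B) `+` B) @[k --> \oo] --> 0%E.

Definition two_set_partition (i : 'I_2) : set X := if i == 0 then B else ~` B.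

Lemma is_partition_two_set : is_partition two_set_partition.
Proof.
split.
- by move=> i; rewrite /two_set_partition; case: ifP => // _; exact: measurableC.
- move=> i j _ _ [x []]; rewrite /two_set_partition.
  case: ifPn => [/eqP ->|i0]; case: ifPn => [/eqP ->|j0]// _ _.
  by move: i0 j0; case: i j => [[|[|?]] ?] [[|[|?]] ?]// *; exact: val_inj.
- apply/seteqP; split=> // x _; have [Bx|nBx] := pselect (B x).
    by exists 0.
  by exists 1.
Qed.

Lemma part_index_two_set x x' : (x \in B) = (x' \in B) ->
  part_index two_set_partition x = part_index two_set_partition x'.
Proof.
move=> xx'; apply: part_index_eq => i; rewrite /two_set_partition.
by case: ifP => _ //; rewrite !in_setC xx'.
Qed.

Lemma leq_add_increasing a b : (n a + b <= n (a + b))%N.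
Proof.
elim: b => [|b IH]; first by rewrite !addn0.
by rewrite !addnS (leq_ltn_trans IH)// nlt.
Qed.

(** The offsets are taken so far along the rigidity sequence that all the
    [K * (N + 1)] events that [T^(m i + j) x] and [T^j x] lie on different sides
    of [B] have total measure at most [1 / (N + 1)].  Outside of them the name
    along the blocks is a copy of the name along [{0,...,N}]. *)
Lemma rigid_blocks (K N : nat) : exists m : nat -> nat,
  (forall i i', (i < i')%N -> (m i + N.+1 <= m i')%N) /\
  covering mu T two_set_partition (blocks m K N.+1) (N.+1%:R^-1) (2 ^ N.+1).
Proof.
pose del : R := ((K.+1 * N.+1 * N.+1)%:R)^-1.
have del0 : 0 < del by rewrite invr_gt0 ltr0n.
have mR k := measurable_return mT (n k) mB.
have [k0 hk0] := (cvg_mu0P mu mR).1 nB _ del0.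
pose m i := n (k0 + N.+1 * i)%N.
exists m; split.
  move=> i i' ii'; apply: leq_trans (leq_add_increasing _ _) _; rewrite /m.
  have : (k0 + N.+1 * i + N.+1 <= k0 + N.+1 * i')%N.
    by rewrite -addnA -mulnSr leq_add2l leq_mul2l ii' orbT.
  by rewrite leq_eqVlt => /orP[/eqP ->//|/nlt/ltnW].
pose s := [seq (i, j) | i <- iota 0 K, j <- iota 0 N.+1].
pose W (p : nat * nat) :=
  iter p.2 T @^-1` ((iter (m p.1) T @^-1` B) `+` B).
have mW p : measurable (W p) by apply: measurable_iter => //; exact: mR.
pose bad := \big[setU/set0]_(p <- s) W p.
have mbad : measurable bad by exact: bigsetU_measurable.
have badle : Pr mu bad <= N.+1%:R^-1.
  apply: le_trans (Pr_bigU mu s mW) _.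
  apply: (@le_trans _ _ (\sum_(p <- s) del)).
    apply: ler_sum => p _; rewrite Pr_iter//; last exact: mR.
    by apply: hk0; exact: leq_addr.
  rewrite big_const_seq iter_addr_0 count_predT size_allpairs !size_iota.
  rewrite -[leLHS]mulr_natr /del ler_pdivrMl ?ltr0n// [leRHS]mulrC.
  rewrite ler_pdivlMl ?ltr0n//.
  by rewrite -!natrM ler_nat; nia.
have -> : (2 ^ N.+1 = 2 ^ #|'I_N.+1|)%N by rewrite card_ord.
apply: (@covering_names _ _ _ _ _ _ _ _ (fun j : 'I_N.+1 => iter j T @^-1` B)
  (~` bad)).
- by move=> j; exact: measurable_iter.
- exact: measurableC.
- by rewrite invr_ge0.
- by rewrite PrC// lerD2l lerN2.
move=> x x' xb x'b xx'.
rewrite /hamming big_seq big1 ?mul0r ?invr_ge0// => f /blocksP[i [j [iK jN ->]]].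
have back y : ~ bad y -> (iter (m i + j) T y \in B) = (iter j T y \in B).
  move=> yb; rewrite iterD; apply: contrapT => h; apply: yb.
  rewrite /bad -bigcup_seq; exists (i, j).
    by apply/allpairsP; exists (i, j); rewrite !mem_iota.
  rewrite /W /setY /setD /=.
  have [b1|b1] := pselect (B (iter (m i) T (iter j T y)));
  have [b2|b2] := pselect (B (iter j T y)).
  - by exfalso; apply: h; rewrite !mem_set.
  - by left.
  - by right.
  - by exfalso; apply: h; rewrite !memNset.
rewrite (part_index_two_set (_ : _ = (iter (m i + j) T x' \in B))) ?eqxx//.
by rewrite !back//; exact: (xx' (Ordinal jN)).
Qed.

(** The covering number of the [N]-th set is at most [2^(N+1)], and the number
    of blocks is chosen to make the logarithm of its cardinality at least
    [(N+1) 2^(N+1)], so the ratio is at most [1 / (N+1)]. *)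
Lemma rigid_slow_folner : exists F, folner R F /\
  (h_slow mu T (fun n : nat => ln (n%:R : R)) F two_set_partition <= 0)%E.
Proof.
pose L (N : nat) : R := N.+1%:R * (2 ^ N.+1)%:R.
pose K (N : nat) := (Num.truncn (expR (L N))).+1.
have L0 N : 0 < L N by rewrite mulr_gt0// ltr0n expn_gt0.
have /choice[m hm] : forall N, exists m : nat -> nat,
  (forall i i', (i < i')%N -> (m i + N.+1 <= m i')%N) /\
  covering mu T two_set_partition (blocks m (K N) N.+1) (N.+1%:R^-1) (2 ^ N.+1).
  by move=> N; exact: rigid_blocks.
pose F N := blocks (m N) (K N) N.+1.
have cF N : #|` F N| = (K N * N.+1)%N by apply: card_blocks; case: (hm N).
exists F; split.
  apply: (@folner_blocks R F K) => // N k.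
  by rewrite cF; apply: blocks_shift; case: (hm N).
have lnF N : L N <= ln (#|` F N|%:R : R).
  rewrite -ler_expR lnK ?posrE ?cF ?ltr0n ?muln_gt0//.
  apply: (@le_trans _ _ (K N)%:R); first by rewrite ltW// truncnS_gt.
  by rewrite ler_nat leq_pmulr.
apply: ge_ereal_sup => _ [eps /= eps0 <-].
apply/lee_addgt0Pr => e e0; rewrite add0e.
apply: limn_esup_le.
exists (Num.truncn (eps^-1 + e^-1)) => N hN; rewrite lee_fin.
have N1 : eps^-1 + e^-1 < N.+1%:R.
  by apply: lt_le_trans (truncnS_gt _) _; rewrite ler_nat.
have Ne : N.+1%:R^-1 <= eps.
  rewrite invf_ple ?posrE// (le_trans _ (ltW N1))// lerDl invr_ge0 ltW//.
have Ne' : N.+1%:R^-1 <= e.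
  rewrite invf_ple ?posrE// (le_trans _ (ltW N1))// lerDr invr_ge0 ltW//.
have cN : covering mu T two_set_partition (F N) eps (2 ^ N.+1).
  by apply: covering_mono Ne _; case: (hm N).
have lnF0 := lt_le_trans (L0 N) (lnF N).
rewrite ler_pdivrMr// (le_trans (cov_le cN))//.
apply: (@le_trans _ _ (N.+1%:R^-1 * L N)).
  by rewrite /L mulrA mulVf ?mul1r// pnatr_eq0.
apply: ler_pM => //; last exact: ltW.
Qed.

End RigidSet.

(** * Mild mixing and slow entropy *)

Theorem corollary4p16 (R : realType) (d : measure_display)
    (X : measurableType d) (mu : probability X R) (T : X -> X)
    (hX : mp_system mu T) :
  mildly_mixing mu T <->
  forall (r : nat) (P : 'I_r -> set X) (F : nat -> {fset nat}),
    is_partition P -> nontrivial_partition mu P -> folner R F ->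
    (0 < h_slow mu T (fun n : nat => ln (n%:R : R)) F P)%E.
Proof.
have [_ [mT [T' mT' [TK T'K]] muT]] := hX.
split=> [mm r P F PP nP folF|h].
- rewrite ltNge; apply/negP => slow0.
  have mP i : measurable (P i) by case: PP => mP _ _; exact: mP.
  have [i0 Pi0] : exists i, 0 < Pr mu (P i).
    apply: contrapT => h.
    have P0 : \sum_(i < r) Pr mu (P i) = 0.
      apply: big1 => i _; apply/eqP; rewrite eq_le Pr_ge0 andbT leNgt.
      by apply/negP => Pi; apply: h; exists i.
    have := Pr_bigU mu (index_enum 'I_r) mP; rewrite P0.
    have -> : \big[setU/set0]_(i <- index_enum 'I_r) P i = setT.
      by case: PP => _ _ <-; rewrite -bigcup_seq; apply/seteqP; split=> x [i _ ?];
        exists i => //=; rewrite mem_index_enum.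
    by rewrite /Pr probability_setT ler10.
  have Pi1 : Pr mu (P i0) < 1.
    rewrite lt_neqAle; apply/andP; split.
      by have := nP i0; rewrite PrE// eqe.
    by rewrite -lee_fin -PrE//; exact: probability_le1.
  have [n [n0 nlt nP0]] := rigidity_times mT muT PP folF slow0 i0.
  apply: (itinerary_nontrivial (mT := mT) (mT' := mT') (mA := mP i0) Pi0 Pi1).
  apply: mm; first exact: (mp_system_itinerary mT mT' TK muT (mP i0)).
  - exact: (is_factor_itinerary mu mT mT' TK (mP i0)).
  - exact: (rigid_itinerary mT mT' TK T'K muT (mP i0) n0 nlt).
- move=> d' Y nu S [sY [mS _ nuS]] [pi [mpi mupi piTS]] [n [_ nlt nS]].
  apply: contrapT => /(nontrivial_set sY)[A [mA A0 A1]].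
  pose B := pi @^-1` A.
  have mB : measurable B by rewrite -[X in measurable X]setTI; exact: mpi.
  have PB : Pr mu B = Pr nu A by rewrite /Pr mupi.
  have nB := rigid_pullback mT muT mS mpi mupi piTS mA (nS A mA).
  have [F [folF slow0]] := rigid_slow_folner mT muT mB nlt nB.
  have nP : nontrivial_partition mu (two_set_partition B).
    move=> i; apply/eqP; rewrite /two_set_partition.
    case: ifP => _ /(congr1 fine); rewrite -/(Pr mu _) ?PrC// PB /=; lra.
  have := h _ _ F (is_partition_two_set mB) nP folF.
  by rewrite ltNge slow0.
Qed.
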